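(* Let $(X,\mathbb{U})$ be a pre-Lindelöf uniform space with $|X|<\mathfrak{d}$. Then $(X,\mathbb{U})$ is ${\sf M}$-bounded.
   Context: A uniformity on a set $X$ is a nonempty family $\mathbb{U}$ of symmetric subsets of $X\times X$ containing the diagonal $\Delta=\{(x,x):x\in X\}$ (entourages) such that: (i) if $U\in\mathbb{U}$ and $V\supseteq U$ is a symmetric subset of $X\times X$, then $V\in\mathbb{U}$; (ii) $U,V\in\mathbb{U}$ implies $U\cap V\in\mathbb{U}$; (iii) for every $U\in\mathbb{U}$ there is $V\in\mathbb{U}$ with $V\circ V\subseteq U$; (iv) $\bigcap\mathbb{U}=\Delta$. The pair $(X,\mathbb{U})$ is a uniform space. For $U\in\mathbb{U}$, $x\in X$, $F\subseteq X$: $U[x]=\{y\in X:(x,y)\in U\}$ and $U[F]=\bigcup_{x\in F}U[x]$. $(X,\mathbb{U})$ is pre-Lindelöf if for each $U\in\mathbb{U}$ there is a countable $A\subseteq X$ with $U[A]=X$. $(X,\mathbb{U})$ is ${\sf M}$-bounded (Menger-bounded) if for each sequence $(U_n)_{n\in\mathbb{N}}$ of members of $\mathbb{U}$ there is a sequence $(F_n)$ of finite subsets of $X$ such that $\bigcup_{n\in\mathbb{N}}U_n[F_n]=X$. For $f,g\in\mathbb{N}^{\mathbb{N}}$, $f\leq^*g$ means $f(n)\leq g(n)$ for all but finitely many $n$. A set $A\subseteq\mathbb{N}^{\mathbb{N}}$ is dominating if for each $g\in\mathbb{N}^{\mathbb{N}}$ there is $f\in A$ with $g\leq^*f$. $\mathfrak{d}$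 is the minimum cardinality of a dominating subset of $\mathbb{N}^{\mathbb{N}}$. *)

(* Defs.v *)
From HB Require Import structures.
From mathcomp Require Import all_boot all_order.
From mathcomp Require Import boolp classical_sets functions cardinality filter.
From mathcomp Require Import topology.

Set Implicit Arguments.
Unset Strict Implicit.
Unset Printing Implicit Defensive.

Local Open Scope classical_set_scope.
Local Open Scope relation_scope.
Local Open Scope card_scope.

(* A uniformity U on X in the convention "all members of U are symmetric" is
   the family of symmetric members of the filter [entourage]; conversely that
   filter consists of all supersets of members of U.  The axioms of
   [uniformType] do not include separation, see [separated_uniformity]. *)
Definition uniformity (X : uniformType) : set (set (X * X)) :=
  [set U | entourage U /\ U^-1 = U].
Arguments uniformity X : clear implicits.

Definition separated_uniformity (X : uniformType) : Prop :=
  \bigcap_(U in uniformity X) U = diagonal.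

(* U[F]; note that U[x] = {y | (x, y) in U} is [xsection U x] *)
Definition uimage (X : Type) (U : set (X * X)) (F : set X) : set X :=
  \bigcup_(x in F) xsection U x.

Definition pre_Lindelof (X : uniformType) : Prop :=
  forall U, uniformity X U ->
    exists A : set X, countable A /\ uimage U A = [set: X].

Definition Menger_bounded (X : uniformType) : Prop :=
  forall U : nat -> set (X * X), (forall n, uniformity X (U n)) ->
    exists F : nat -> set X, (forall n, finite_set (F n)) /\
      \bigcup_n uimage (U n) (F n) = [set: X].

Definition le_star (f g : nat -> nat) : Prop :=
  finite_set [set n | ~ (f n <= g n)%N].

Definition dominating (A : set (nat -> nat)) : Prop :=
  forall g, exists2 f, A f & le_star g f.

Definition card_lt (T U : Type) (A : set T) (B : set U) : Prop :=
  A #<= B /\ ~ (B #<= A).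

(* K is a dominating set of minimum cardinality, i.e. |K| is the cardinal d *)
Definition min_dominating (K : set (nat -> nat)) : Prop :=
  dominating K /\ forall D, dominating D -> K #<= D.

Lemma ex_min_card (T : pointedType) (P : set (set T)) : P !=set0 ->
  exists K, P K /\ forall D, P D -> K #<= D.
Proof.
move=> [D0 PD0].
(* Simultaneous partial injections between all the members of P *)
pose Q (S : set (set T -> T)) :=
  (forall p D, S p -> P D -> D (p D)) /\
  (forall p q D, S p -> S q -> P D -> p D = q D -> p = q).
have [F FQ Ftot|S [[S1 S2] Smax]] := @Zorn_bigcup _ Q.
  split=> [p D [A FA Ap]|p q D [A FA Ap] [B FB Bq] PD].
    by have [/(_ p D Ap)] := FQ _ FA.
  have [AB|BA] := Ftot _ _ FA FB.
    have [_ B2] := FQ _ FB; exact: (B2 p q D (AB _ Ap) Bq PD).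
  have [_ A2] := FQ _ FA; exact: (A2 p q D Ap (BA _ Bq) PD).
have [[K [PK Kim]]|nK] :=
    pselect (exists K, P K /\ forall x, K x -> exists2 p, S p & p K = x).
  exists K; split=> // D PD.
  have /choice[r rP] : forall x, exists p, K x -> S p /\ p K = x.
    move=> x; have [/Kim[p Sp pK]|nKx] := pselect (K x); first by exists p.
    by exists (fun=> point).
  have rinj : {in K &, injective (fun x => r x D)}.
    move=> x y /set_mem/rP[Sx rx] /set_mem/rP[Sy ry] rxy.
    by rewrite -rx -ry (S2 _ _ _ Sx Sy PD rxy).
  rewrite -(card_le_eql (inj_card_eq rinj)).
  apply: subset_card_le.
  by move=> _ [x /rP[Sx _] <-]; exact: (S1 _ _ Sx PD).
have /choice[p pP] : forall D, exists x,
    P D -> D x /\ forall q, S q -> q D <> x.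
  move=> D; have [PD|] := pselect (P D); last by exists point.
  apply: contrapT => nx; case: nK; exists D; split=> // x Dx.
  apply: contrapT => nq; case: nx; exists x => _; split=> // q Sq qx.
  by case: nq; exists q.
exfalso; apply: (Smax (S `|` [set p])); last first.
  split=> [q D [Sq|->] PD|q r D [Sq|->] [Sr|->] PD //].
  - exact: (S1 _ _ Sq PD).
  - exact: (pP D PD).1.
  - exact: (S2 _ _ _ Sq Sr PD).
  - by move=> e; case: ((pP D PD).2 _ Sq e).
  - by move=> e; case: ((pP D PD).2 _ Sr (esym e)).
split; first by move=> q; left.
move=> /(_ p (or_intror erefl)) Sp.
exact: ((pP D0 PD0).2 _ Sp erefl).
Qed.

Lemma ex_min_dominating : exists K, min_dominating K.
Proof.
apply: (@ex_min_card _ dominating); exists setT => g; exists g => //.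
rewrite /le_star (_ : mkset _ = set0); first exact: finite_set0.
by apply/seteqP; split=> n //=; rewrite leqnn.
Qed.

(* Main.v *)
(** Fix countable sets A_n with U_n[A_n] = X, injected into the integers by
    e_n.  Each point x gives a function f_x, where f_x(n) is the index e_n(a)
    of some a in A_n with x in U_n[a].  There are at most |X| < d such
    functions, so some g is dominated by none of them: for every x there is n
    with f_x(n) < g(n).  The finite sets F_n = {a in A_n | e_n(a) < g(n)} are
    then as required. *)
Require Import Defs.
From mathcomp Require Import all_boot all_order.
From mathcomp Require Import boolp classical_sets functions cardinality filter.
From mathcomp Require Import topology.

Local Open Scope classical_set_scope.
Local Open Scope card_scope.

Lemma finite_bounded_index (T : Type) (A : set T) (e : T -> nat) (k : nat) :
  {in A &, injective e} -> finite_set [set a | A a /\ e a < k].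
Proof.
move=> einj; set B := [set a | _].
have einjB : {in B &, injective e}.
  by move=> a b /set_mem[Aa _] /set_mem[Ab _]; apply: einj; apply/mem_set.
rewrite -(eq_finite_set (inj_card_eq einjB)).
by apply: (sub_finite_set _ (finite_II k)) => _ [a [_ ak] <-].
Qed.

(** Otherwise every [g] lies pointwise below some [f x], so the range of [f] is dominating; by
    minimality [K] injects into that range, hence into [X], against [card_lt]. *)
Lemma lt_min_dominating_escape (X : Type) (K : set (nat -> nat))
    (f : X -> nat -> nat) :
  min_dominating K -> card_lt [set: X] K ->
  exists g, forall x, exists n, f x n < g n.
Proof.
move=> [_ Kmin] [_ nKX]; apply: contrapT => ng; apply: nKX.
apply: (card_le_trans _ (card_image_le f setT)); apply: Kmin => g.
have [x fx] : exists x, forall n, ~ f x n < g n.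
  apply: contrapT => nx; apply: ng; exists g => x; apply: contrapT => nn.
  by apply: nx; exists x => n fg; apply: nn; exists n.
exists (f x); first by exists x.
(* The bound holds at every index: no exceptions. *)
rewrite /le_star (_ : mkset _ = set0); first exact: finite_set0.
by apply/seteqP; split=> n //= []; rewrite leqNgt; apply/negP/fx.
Qed.

Theorem theorem3p3 (X : uniformType) (K : set (nat -> nat))
  (sepX : separated_uniformity X) (preLX : pre_Lindelof X)
  (minK : min_dominating K) (X_lt_d : card_lt [set: X]%classic K) :
  Menger_bounded X.
Proof.
move=> U unifU.
have /choice[A AP] := fun n => preLX _ (unifU n).
have /choice[e einj] : forall n, exists e : X -> nat, {in A n &, injective e}.
  move=> n; have [/countable_injP[e einj] _] := AP n.
  by exists e.
(* Choosing over pairs [(x, n)] fixes all centres at once; [e n (a (x, n))] serves as [f_x(n)]. *)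
have /choice[a aP] : forall p : X * nat,
    exists a, A p.2 a /\ xsection (U p.2) a p.1.
  move=> p; have [_ cover] := AP p.2.
  have : [set: X] p.1 by [].
  by rewrite -cover => -[a Aa Uax]; exists a.
have [g gP] := lt_min_dominating_escape X K
  (fun x n => e n (a (x, n))) minK X_lt_d.
exists (fun n => [set b | A n b /\ e n b < g n]); split=> [n|].
  exact: finite_bounded_index.
apply/seteqP; split=> // x _; have [n ltg] := gP x.
have [Aa Ua] := aP (x, n).
by exists n => //; exists (a (x, n)).
Qed.
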